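(* Let $X$ be a Hausdorff space and $f:X\to X$ a perfect mapping. If $\Lambda$ is a non-empty closed subset of $X$ that is invariant under $f$, i.e., $f(\Lambda)\subseteq\Lambda$, then $c(f|_{\Lambda})\le c(f)$, where $f|_\Lambda:\Lambda\to\Lambda$ is the restriction of $f$ and $c$ denotes co-compact entropy.
   Context: A continuous mapping between Hausdorff spaces is called perfect if it is a closed mapping and all its fibers (preimages of single points of the codomain) are compact. (The restriction of a perfect self-map to a closed invariant subspace is a perfect self-map of that subspace.) Let $X$ be a (non-empty) Hausdorff space. An open set $U\subseteq X$ is co-compact if $X\setminus U$ is a compact subset of $X$. A co-compact open cover of $X$ is an open cover of $X$ all of whose elements are co-compact. Every co-compact open cover has a finite subcover. For a co-compact open cover $\mathcal{U}$ of $X$, $N(\mathcal{U})$ is the smallest cardinality of a subcover of $\mathcal{U}$, and $H(\mathcal{U})=\log N(\mathcal{U})$. For covers $\mathcal{U},\mathcal{V}$, $\mathcal{U}\bigvee\mathcal{V}=\{U\cap V: U\in\mathcal{U}, V\in\mathcal{V}\}$, and for a map $f:X\to X$, $f^{-i}(\mathcal{U})=\{f^{-i}(U):U\in\mathcal{U}\}$ (preimages under the $i$-th iterate). For a perfect mapping $f:X\to X$ and a co-compact open cover $\mathcal{U}$, the co-compact entropy of $f$ relative to $\mathcal{U}$ is $$c(f,\mathcal{U})=\lim_{n\to\infty}\frac1n H\Big(\bigvee_{i=0}^{n-1}f^{-i}(\mathcal{U})\Big)$$ (this limit exists), and the co-compact entropy of $f$ is $c(f)=\sup_{\mathcal{U}}c(f,\mathcal{U})\in[0,\infty]$,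 the supremum being over all co-compact open covers $\mathcal{U}$ of $X$. The entropy $c(f|_\Lambda)$ is defined the same way for the space $\Lambda$ with the subspace topology. *)

(* Defs.v *)
From mathcomp Require Import all_boot all_order all_algebra.
From mathcomp Require Import all_classical all_reals all_analysis.

Set Implicit Arguments.
Unset Strict Implicit.
Unset Printing Implicit Defensive.

Import Order.TTheory GRing.Theory Num.Theory.
Import numFieldNormedType.Exports.

Local Open Scope classical_set_scope.
Local Open Scope ring_scope.

(* The Hausdorff property of the two spaces is kept as a separate hypothesis. *)
Definition perfect_map (X Y : topologicalType) (f : X -> Y) : Prop :=
  [/\ continuous f,
      forall C : set X, closed C -> closed (f @` C)
    & forall y : Y, compact (f @^-1` [set y])].

Definition is_cover (T : Type) (U : set (set T)) : Prop :=
  \bigcup_(A in U) A = setT.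

Definition cocompact_open_cover (X : topologicalType) (U : set (set X)) : Prop :=
  is_cover U /\ forall A, U A -> open A /\ compact (~` A).

Definition subcover_card (T : Type) (U : set (set T)) (n : nat) : Prop :=
  exists V : set (set T), [/\ V `<=` U, is_cover V & (V #= `I_n)%card].

(* N(U); the default 0 is only returned when U has no finite subcover. *)
Definition min_subcover (T : Type) (U : set (set T)) : nat :=
  xget 0%N [set n | subcover_card U n /\
                    forall m, subcover_card U m -> (n <= m)%N].

Definition cover_H (R : realType) (T : Type) (U : set (set T)) : R :=
  ln (min_subcover U)%:R.

Definition cover_join (T : Type) (U V : set (set T)) : set (set T) :=
  [set A `&` B | A in U & B in V].

Definition cover_preimage (S T : Type) (g : S -> T) (U : set (set T)) :
    set (set S) :=
  [set g @^-1` A | A in U].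

(* The join of f^{-i}(U) for 0 <= i < n; the trivial cover {T} is a neutral
   element of cover_join, so it only shows up when n = 0. *)
Definition iter_join (T : Type) (f : T -> T) (U : set (set T)) (n : nat) :
    set (set T) :=
  \big[@cover_join T/[set setT]]_(i < n) cover_preimage (iter i f) U.

Definition cocompact_entropy_rel (R : realType) (T : Type) (f : T -> T)
    (U : set (set T)) : R :=
  limn (fun n : nat => n%:R^-1 * cover_H R (iter_join f U n)).

Definition cocompact_entropy (R : realType) (X : topologicalType) (f : X -> X) :
    \bar R :=
  ereal_sup [set (cocompact_entropy_rel R f U)%:E | U in
    [set U : set (set X) | cocompact_open_cover U]].

Definition restr_self (T : Type) (L : set T) (f : T -> T)
    (fL : f @` L `<=` L) (x : L) : L :=
  exist _ (f (val x)) (mem_set (fL _ (imageP f (set_valP x)))).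

(* Main.v *)
(* A co-compact open cover U of L lifts to the cover of X by the sets
   A `|` ~` L = ~` (~` A), A in U: their complements are compact in X, hence
   closed.  Pulling a subcover of the n-th join of the lifted cover back along
   the inclusion of L gives a subcover of the n-th join of U, so the entropies
   compare term by term.  Since the entropy is a limit, both sequences must be
   known to converge; this is Fekete's lemma. *)
Require Import Defs.
From HB Require Import structures.
From mathcomp Require Import all_boot all_order all_algebra.
From mathcomp Require Import all_classical all_reals all_analysis.
From mathcomp Require Import zify lra.
Import Order.TTheory GRing.Theory Num.Theory.
Import numFieldNormedType.Exports.

Set Implicit Arguments.
Unset Strict Implicit.
Unset Printing Implicit Defensive.

Local Open Scope classical_set_scope.
Local Open Scope ring_scope.

(** * Fekete's lemma for non-negative subadditive sequences *)

Section fekete.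
Variables (R : realType) (u : nat -> R).
Hypothesis u_ge0 : forall n, 0 <= u n.
Hypothesis u_subadd : forall m n, u (m + n)%N <= u m + u n.

Lemma subadditive_mulnD (k q r : nat) : u (q * k + r)%N <= q%:R * u k + u r.
Proof.
elim: q => [|q IHq]; first by rewrite mul0n add0n mul0r add0r.
rewrite mulSn -addnA -natr1 mulrDl mul1r.
apply: le_trans (u_subadd _ _) _.
lra.
Qed.

Lemma fekete : cvgn (fun n => n%:R^-1 * u n).
Proof.
(* The index starts at 1: since [0^-1 = 0], the term at 0 would vanish and force the infimum to be
   0. *)
pose E := [set n.+1%:R^-1 * u n.+1 | n in [set: nat]].
have lbE : lbound E 0 by move=> _ [n _ <-]; rewrite mulr_ge0 ?invr_ge0.
have hE : has_inf E by split; [exists (1%:R^-1 * u 1), 0%N | exists 0].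
apply/cvg_ex; exists (inf E); apply/cvgrPdist_le => e; move: (e : R) => {}e e0.
have e20 : 0 < e / 2 by rewrite divr_gt0.
have [_ [k _ <-] ke] := inf_adherent e20 hE.
(* [M] bounds [u] at every remainder modulo [k.+1], independently of [n], so its share [M / n] tends
   to 0. *)
pose M := \sum_(i < k.+1) u i.
have uM r : (r < k.+1)%N -> u r <= M.
  move=> rk; rewrite /M (bigD1 (Ordinal rk)) //= lerDl.
  by apply: sumr_ge0.
near=> n.
have n0 : (0 < n)%N by near: n; exists 1%N.
have n0R : 0 < n%:R :> R by rewrite ltr0n.
have lo : inf E <= n%:R^-1 * u n.
  apply: ge_inf; first by exists 0.
  by exists n.-1 => //; rewrite prednK.
have MnN : 2 * M / e <= n%:R by near: n; exact: nbhs_infty_ger.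
have Mn : M <= e / 2 * n%:R.
  by move: MnN; rewrite ler_pdivrMr// => ?; lra.
have hi : n%:R^-1 * u n <= inf E + e.
  (* In the division of [n] by [k.+1], the quotient part costs at most [n * (inf E + e / 2)] by the
     choice of [k], and the remainder at most [n * (e / 2)]. *)
  rewrite mulrC ler_pdivrMr// {1}(divn_eq n k.+1).
  apply: le_trans (subadditive_mulnD _ _ _) _.
  have ur : u (n %% k.+1) <= e / 2 * n%:R.
    by apply: le_trans Mn; apply: uM; rewrite ltn_mod.
  have qk : (n %/ k.+1)%:R * u k.+1 <= n%:R * (k.+1%:R^-1 * u k.+1).
    rewrite mulrA ler_wpM2r// ler_pdivlMr ?ltr0n//.
    by rewrite -natrM ler_nat leq_divM.
  have nk : n%:R * (k.+1%:R^-1 * u k.+1) <= n%:R * (inf E + e / 2).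
    by rewrite ler_pM2l// ltW.
  apply: le_trans (lerD (le_trans qk nk) ur) _.
  by rewrite mulrC -mulrDl -addrA -splitr.
by rewrite ler_norml; apply/andP; split; lra.
Unshelve. all: by end_near.
Qed.

End fekete.

(** * Finite subcovers listed by sequences *)

Definition enum_subcover (T : Type) (U : set (set T)) (n : nat) : Prop :=
  exists g : nat -> set T,
    (forall i, (i < n)%N -> U (g i)) /\
    (forall x, exists2 i, (i < n)%N & g i x).

Lemma subcover_card_enum (T : Type) (U : set (set T)) (n : nat) :
  subcover_card U n -> enum_subcover U n.
Proof.
move=> [V [VU covV /card_esym/card_set_bijP[g [gf _ gs]]]].
exists g; split=> [i ilt|x]; first exact/VU/gf.
have : (\bigcup_(A in V) A) x by rewrite covV.
by move=> [A /gs[i ilt <-] Ax]; exists i.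
Qed.

(** A list may repeat members, hence only [m <= n]. This slack lets lists be multiplied and pulled
    back even when distinct members become equal. *)
Lemma enum_subcover_card (T : Type) (U : set (set T)) (n : nat) :
  enum_subcover U n -> exists2 m, subcover_card U m & (m <= n)%N.
Proof.
move=> [g [gU gcov]].
have Vn : (g @` `I_n #<= `I_n)%card by exact: card_image_le.
have /finite_setP[m Vm] : finite_set (g @` `I_n).
  exact/finite_image/finite_II.
exists m.
  exists (g @` `I_n); split=> // [_ [i ilt <-]|]; first exact: gU.
  rewrite /is_cover -subTset => x _; have [i ilt gix] := gcov x.
  by exists (g i) => //; exists i.
by rewrite -card_le_II -(card_le_eql Vm).
Qed.

(** One finite list rules out the default value of [min_subcover]: the possible cardinalities then
    form a non-empty set of naturals, which has a least element. *)
Lemma min_subcoverP (T : Type) (U : set (set T)) (n : nat) :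
  enum_subcover U n ->
  enum_subcover U (min_subcover U) /\ (min_subcover U <= n)%N.
Proof.
move=> /enum_subcover_card[m Um mn].
have /(xgetPex 0%N)[Umin minU] : exists k,
    [set k | subcover_card U k /\
      forall l, subcover_card U l -> (k <= l)%N] k.
  have exU : exists k, `[< subcover_card U k >] by exists m; apply/asboolP.
  case: (ex_minnP exU) => k /asboolP Uk kmin.
  by exists k; split=> // l Ul; apply: kmin; apply/asboolP.
split; first exact: subcover_card_enum.
exact: leq_trans (minU _ Um) mn.
Qed.

Lemma enum_subcover_gt0 (T : Type) (x : T) (U : set (set T)) (n : nat) :
  enum_subcover U n -> (0 < n)%N.
Proof. by move=> [g [_ /(_ x)[i ilt _]]]; exact: leq_ltn_trans ilt. Qed.

(** One member [A0] leaves only a compact set uncovered, and finitely many further members cover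
    that. *)
Lemma cocompact_enum_subcover (X : topologicalType) (x : X) (U : set (set X)) :
  cocompact_open_cover U -> exists n, enum_subcover U n.
Proof.
move=> [covU cocU].
have [A0 UA0 _] : (\bigcup_(A in U) A) x by rewrite covU.
(* [compact_cover] is stated for pointed spaces only. *)
pose pX : ptopologicalType := HB.pack X (isPointed.Build X x).
have : @cover_compact pX (~` A0).
  by rewrite -compact_cover; exact: (cocU _ UA0).2.
move=> /(_ _ U id)[A UA||D DU covD]; first exact: (cocU _ UA).1.
  by move=> y _; have : (\bigcup_(A in U) A) y by rewrite covU.
pose s := A0 :: finmap.enum_fset D.
exists (size s), (nth A0 s); split=> [i ilt|y].
  have : nth A0 s i \in s by exact: mem_nth.
  rewrite inE => /orP[/eqP->//|/DU]; exact: set_mem.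
have [A0y|/covD[A /= AD Ay]] := pselect (A0 y); first by exists 0%N.
have As : A \in s by rewrite inE; apply/orP; right.
by exists (index A s); [rewrite index_mem|rewrite nth_index].
Qed.

(** * Iterated joins and the subadditivity of their entropy *)

Lemma big_cover_join (T : Type) (F : nat -> T -> T) (U : set (set T))
    (n : nat) :
  \big[@cover_join T/[set setT]]_(i < n) cover_preimage (F i) U =
  [set \bigcap_(i in `I_n) F i @^-1` h i |
    h in [set h : nat -> set T | forall i, (i < n)%N -> U (h i)]].
Proof.
elim: n F => [|n IHn] F.
  rewrite big_ord0 II0; apply/seteqP; split=> [_ ->|_ [h _ <-]].
    by exists (fun=> setT) => //; rewrite bigcap_set0.
  by rewrite bigcap_set0.
have bigcap_recl (h : nat -> set T) :
    \bigcap_(i in `I_n.+1) F i @^-1` h i =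
    F 0%N @^-1` h 0%N `&` \bigcap_(i in `I_n) F i.+1 @^-1` h i.+1.
  apply/seteqP; split=> [y hy|y [h0 hS] [|i]//]; last exact: hS.
  by split=> [|i ilt]; [exact: (hy 0%N)|exact: (hy i.+1)].
(* Peeling off the first factor leaves the shifted family, which is why the induction runs over
   arbitrary [F] and not just iterates. *)
rewrite big_ord_recl (IHn (fun i => F i.+1)).
apply/seteqP; split=> [_ [_ [A UA <-] [_ [h hU <-] <-]]|_ [h hU <-]].
  exists (fun i => if i is j.+1 then h j else A).
    by move=> [|i] //; exact: hU.
  by rewrite bigcap_recl.
exists (F 0%N @^-1` h 0%N); first by exists (h 0%N) => //; exact: hU.
exists (\bigcap_(i in `I_n) F i.+1 @^-1` h i.+1); last by rewrite bigcap_recl.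
by exists (fun i => h i.+1) => // i ilt; exact: hU.
Qed.

Section iter_join.
Variables (T : Type) (f : T -> T) (U : set (set T)).

Lemma iter_joinE (n : nat) :
  iter_join f U n =
  [set \bigcap_(i in `I_n) iter i f @^-1` h i |
    h in [set h : nat -> set T | forall i, (i < n)%N -> U (h i)]].
Proof. exact: (big_cover_join (fun i => iter i f)). Qed.

(** [A] prescribes the first [m] steps of an orbit and [B] the next [n], because [iter (m + i) f] is
    [iter i f] after [iter m f]. *)
Lemma iter_joinD (m n : nat) (A B : set T) :
  iter_join f U m A -> iter_join f U n B ->
  iter_join f U (m + n) (A `&` iter m f @^-1` B).
Proof.
rewrite !iter_joinE => -[h hU <-] [k kU <-].
exists (fun i => if (i < m)%N then h i else k (i - m)%N) => [i ilt|].
  by case: ltnP => im; [exact: hU|apply: kU; lia].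
apply/seteqP; split=> [y hk|y [hy ky] i /= ilt].
  split=> i /= ilt; first by have /= := hk i (ltn_addr _ ilt); rewrite ilt.
  have im : (i + m < m)%N = false by lia.
  by have /= := hk (i + m)%N; rewrite im addnK iterD; apply; lia.
case: ltnP => im; first exact: hy.
have <- : iter (i - m) f (iter m f y) = iter i f y by rewrite -iterD subnK.
apply: (ky (i - m)%N) => /=; lia.
Qed.

Lemma enum_subcover_iter_joinD (m n a b : nat) :
  enum_subcover (iter_join f U m) a -> enum_subcover (iter_join f U n) b ->
  enum_subcover (iter_join f U (m + n)) (a * b).
Proof.
move=> [g [gU gcov]] [h [hU hcov]].
(* The pair [(i, j)] with [j < b] is coded as [i * b + j] and decoded by quotient and remainder. *)
exists (fun i => g (i %/ b)%N `&` iter m f @^-1` h (i %% b)%N).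
split=> [i iab|x].
  have b0 : (0 < b)%N by case: b iab {hU hcov} => //; rewrite muln0.
  by apply: iter_joinD; [apply: gU; rewrite ltn_divLR|apply: hU; rewrite ltn_mod].
have [i ia gi] := gcov x; have [j jb hj] := hcov (iter m f x).
have b0 : (0 < b)%N by exact: leq_ltn_trans jb.
exists (i * b + j)%N; first nia.
by rewrite divnMDl// divn_small// addn0 modnMDl modn_small.
Qed.

(** The bound is crude; what matters is its finiteness, which makes [min_subcover] of every join a
    true minimum. *)
Lemma enum_subcover_iter_join (N n : nat) :
  enum_subcover U N -> enum_subcover (iter_join f U n) (N ^ n).
Proof.
move=> [g [gU gcov]]; elim: n => [|n IHn].
  exists (fun=> setT); split=> [_ _|x]; last by exists 0%N.
  by rewrite /iter_join big_ord0.
rewrite -add1n expnS; apply: enum_subcover_iter_joinD => //.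
exists g; split=> // i iN; rewrite iter_joinE.
exists (fun=> g i) => [j _|]; first exact: gU.
apply/seteqP; split=> y; first by move=> /(_ 0%N isT).
by move=> gy [|j].
Qed.

(** Products of subcovers make [min_subcover] submultiplicative along the joins, so its logarithm is
    subadditive. The point [x] keeps these numbers at least 1, hence the logarithms non-negative. *)
Lemma is_cvg_cocompact_entropy_rel (R : realType) (x : T) (N : nat) :
  enum_subcover U N ->
  cvgn (fun n : nat => n%:R^-1 * cover_H R (iter_join f U n)).
Proof.
move=> UN.
have minP n := min_subcoverP (enum_subcover_iter_join n UN).
have min_gt0 n : (0 < min_subcover (iter_join f U n))%N.
  exact: enum_subcover_gt0 x _ _ (minP n).1.
apply: fekete => [n|m n]; first by rewrite ln_ge0// ler1n.
rewrite /cover_H -lnM ?posrE ?ltr0n// -natrM.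
rewrite ler_ln ?posrE ?ltr0n ?muln_gt0 ?min_gt0// ler_nat.
by apply: (min_subcoverP _).2; apply: enum_subcover_iter_joinD; exact: (minP _).1.
Qed.

End iter_join.

(** * Lifting covers from [L] to [X] and pulling subcovers back *)

Section restriction.
Variables (X : topologicalType) (L : set X).

Definition lift_open (A : set L) : set X := ~` (val @` ~` A).

Lemma preimage_lift_open (A : set L) : val @^-1` lift_open A = A.
Proof.
apply/seteqP; split=> [y ny|y Ay [z nAz /val_inj zy]].
  by apply: contrapT => nAy; apply: ny; exists y.
by apply: nAz; rewrite zy.
Qed.

Lemma cocompact_lift_open (U : set (set L)) :
  hausdorff_space X -> L !=set0 -> cocompact_open_cover U ->
  cocompact_open_cover (lift_open @` U).
Proof.
move=> hX [x Lx] [covU cocU]; split.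
  rewrite /is_cover -subTset => y _.
  have covE (z : L) : exists2 A, U A & A z.
    by have : (\bigcup_(A in U) A) z by rewrite covU.
  have [Ly|nLy] := pselect (L y).
    have [A UA Ay] := covE (exist _ y (mem_set Ly)).
    exists (lift_open A); first by exists A.
    by rewrite -[A]preimage_lift_open in Ay.
  (* A point outside [L] lies in every lifted set; the point [x] of [L] only serves to produce some
     member of [U]. *)
  have [A UA _] := covE (exist _ x (mem_set Lx)).
  exists (lift_open A); first by exists A.
  by move=> [z _ zy]; apply: nLy; rewrite -zy; exact: set_valP.
move=> _ [A UA <-].
have cA : compact (val @` ~` A).
  apply: continuous_compact; last exact: (cocU _ UA).2.
  exact/continuous_subspaceT/initial_continuous.
by rewrite /lift_open setCK openC; split=> //; exact: compact_closed.
Qed.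

Variables (f : X -> X) (fL : f @` L `<=` L).

Lemma val_iter_restr_self (i : nat) (x : L) :
  val (iter i (restr_self fL) x) = iter i f (val x).
Proof. by elim: i => //= i <-. Qed.

(** The inclusion [val] intertwines the iterates of the two maps and its preimage undoes
    [lift_open], so each listed set pulls back to a member of the join on [L]. *)
Lemma enum_subcover_restr_self (U : set (set L)) (n N : nat) :
  enum_subcover (iter_join f (lift_open @` U) n) N ->
  enum_subcover (iter_join (restr_self fL) U n) N.
Proof.
move=> [g [gU gcov]]; exists (fun i => val @^-1` g i).
split=> [i /gU|x]; last exact: gcov.
rewrite !iter_joinE => -[h hU <-].
exists (fun j => val @^-1` h j) => [j /hU[A UA <-]|].
  by rewrite preimage_lift_open.
by apply/seteqP; split=> x hx j /hx /=; rewrite val_iter_restr_self.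
Qed.

End restriction.

Theorem theorem4p3 (R : realType) (X : topologicalType) (f : X -> X)
    (L : set X) (fL : f @` L `<=` L) :
  hausdorff_space X -> perfect_map f -> L !=set0 -> closed L ->
  (cocompact_entropy R (restr_self fL) <= cocompact_entropy R f)%E.
Proof.
move=> hX _ L0 _; apply: ge_ereal_sup => _ [U cU <-].
have [x Lx] := L0; pose xL : L := exist _ x (mem_set Lx).
have cV := cocompact_lift_open hX L0 cU.
have [N UN] := cocompact_enum_subcover xL cU.
have [M VM] := cocompact_enum_subcover x cV.
apply: (@le_trans _ _
  (cocompact_entropy_rel R f ((@lift_open _ _) @` U))%:E); last first.
  by apply: ereal_sup_ubound; exists ((@lift_open _ _) @` U).
rewrite lee_fin; apply: ler_lim.
- exact: is_cvg_cocompact_entropy_rel UN.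
- exact: is_cvg_cocompact_entropy_rel VM.
near=> n; rewrite ler_wpM2l ?invr_ge0//.
have Vn := (min_subcoverP (enum_subcover_iter_join f n VM)).1.
have [Un UVn] := min_subcoverP (enum_subcover_restr_self fL Vn).
(* Positivity of the smaller number gives that of the larger, so [ln] can be compared at both. *)
have Un0 := enum_subcover_gt0 xL Un.
by rewrite ler_ln ?posrE ?ltr0n ?ler_nat// (leq_trans Un0).
Unshelve. all: by end_near.
Qed.
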